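(* Let $\mathbb{F}_q$ be a finite field and $\alpha\in\mathbb{F}_q^*$. Then $$K_n(\alpha I_n)=\sum_{w\in S_n,\;w^2=1}q^{n(n-1)/2+N_w}(q-1)^{e_w}K_1(\alpha)^{f_w},$$ where $S_n$ is the symmetric group on $\{1,\dots,n\}$ and, for $w\in S_n$ with $w^2=1$, $f_w$ is the number of fixed points of $w$, $e_w$ is the number of involution pairs (2-cycles) of $w$ (so $n=2e_w+f_w$), and $$N_w=\left|\{(i,j)\mid 1\le i<j\le n,\ w(j)<w(i)\le j\}\right|.$$
   Context: $\mathbb{F}_q$ is a finite field of characteristic $p$. The additive character $\varphi:\mathbb{F}_q\to\mathbb{C}^*$ is $\varphi(x)=\exp(2\pi i\,\mathrm{Tr}_{\mathbb{F}_q/\mathbb{F}_p}(x)/p)$, and $\psi=\varphi\circ\mathrm{tr}$ on $M_n(\mathbb{F}_q)$, where $\mathrm{tr}$ is the matrix trace. For $a\in M_n(\mathbb{F}_q)$, $K_n(a)=\sum_{x\in \mathrm{GL}_n(\mathbb{F}_q)}\psi(ax+x^{-1})$; in particular $K_1(\alpha)=\sum_{x\in\mathbb{F}_q^*}\varphi(\alpha x+x^{-1})$. $I_n$ is the $n\times n$ identity matrix. The sum includes $w=1$. *)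

(* Defs.v *)
From mathcomp Require Import all_boot all_order all_algebra all_fingroup all_field.
From mathcomp Require Import reals sequences trigo.
From mathcomp Require Import complex.

Set Implicit Arguments.
Unset Strict Implicit.
Unset Printing Implicit Defensive.

Import Order.TTheory GRing.Theory Num.Theory.

Local Open Scope ring_scope.
Local Open Scope complex_scope.

Definition cexp (R : realType) (z : R[i]) : R[i] :=
  (expR (complex.Re z))%:C * (cos (complex.Im z) +i* sin (complex.Im z)).

Section AbsoluteTrace.
Variables (F : finFieldType) (p : nat) (charFp : p \in [pchar F]).

(* [pPrimeCharType charFp] is F seen as a finite extension field of 'F_p. *)
Let L := pPrimeCharType charFp.

(* [galTrace] takes values in L; [absTrace x] is the unique c : 'F_p whose
   image in L is the Galois trace of x (see [absTraceE]), so the default value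
   0 is never used. *)
Definition absTrace (x : F) : 'F_p :=
  odflt 0 [pick c : 'F_p | c%:A == galTrace 1%AS {:L} (x : L) :> L].

Lemma absTraceE (x : F) : (absTrace x)%:A = galTrace 1%AS {:L} (x : L) :> L.
Proof.
rewrite /absTrace; case: pickP => [c /eqP //|nTr].
have galL : galois 1%AS {:L} by exact: (@finField_galois _ L 1%AS {:L}%AS (sub1v _)).
have /vlineP[c Dc] := mem_galTrace galL (memvf (x : L)).
by have:= nTr c; rewrite Dc eqxx.
Qed.

End AbsoluteTrace.

Section Kloosterman.
Variables (R : realType) (F : finFieldType) (p : nat) (charFp : p \in [pchar F]).

Definition addChar (x : F) : R[i] :=
  cexp ((2 * pi)%:C * 'i * (absTrace charFp x : nat)%:R / p%:R).

Definition mxAddChar (n : nat) (x : 'M[F]_n) : R[i] := addChar (\tr x).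

Definition mxKloosterman (n : nat) (a : 'M[F]_n) : R[i] :=
  \sum_(x : 'M[F]_n | x \in unitmx) mxAddChar (a *m x + invmx x).

Definition kloosterman (a : F) : R[i] :=
  \sum_(x : F | x != 0) addChar (a * x + x^-1).

Lemma mxKloosterman1 (a : F) : mxKloosterman (a%:M : 'M_1) = kloosterman a.
Proof.
rewrite /mxKloosterman /kloosterman.
rewrite (reindex (fun b : F => b%:M : 'M[F]_1)) /=; last first.
  exists (fun A : 'M[F]_1 => A 0 0) => A _; last by rewrite -mx11_scalar.
  by rewrite mxE eqxx.
apply: eq_big => [b|b _]; first by rewrite unitmxE det_scalar1 unitfE.
rewrite /mxAddChar invmx_scalar -scalar_mxM raddfD /=.
by rewrite !mxtrace_scalar !mulr1n.
Qed.

End Kloosterman.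

Section InvolutionStatistics.
Variables (n : nat) (w : 'S_n).

Definition num_fixed : nat := #|[set i | w i == i]|.

Definition num_2cycles : nat := #|[set c in porbits w | #|c| == 2%N]|.

(* The points 1..n are represented by 0..n-1, which preserves the order. *)
Definition num_N : nat :=
  #|[set ij : 'I_n * 'I_n | (ij.1 < ij.2)%N & (w ij.2 < w ij.1 <= ij.2)%N]|.

End InvolutionStatistics.

(* Main.v *)
Require Import Defs.
From mathcomp Require Import all_boot all_order all_algebra all_fingroup all_field.
From mathcomp Require Import reals.
From mathcomp Require Import complex.
From mathcomp Require Import exp trigo.
From mathcomp Require Import zify ring lra.

(** Both sides satisfy the recursion
<<
  T_0 = 1,   T_1 = K_1,
  T_(n+2) = q^(n+1) K_1 T_(n+1) + q^(2n+2) (q^(n+1) - 1) T_n,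
>>
    with [K_1 = K_1(alpha)].

    Sums over [GL_(n+2)] ([char_klSS]).  Split the matrices [x] by their first
    row [(a, s)].  If [s = 0] then [x] is block lower triangular, [a] and the
    lower block [y] range independently, the remaining column is free, and the
    summand factors: this is the first term ([row_sum_scalar]).  If [s <> 0],
    conjugating by a matrix that fixes the first basis row vector moves the
    first row to [(0, 1, 0, ..., 0)]; as the summand is a class function, the
    [q (q^(n+1) - 1)] sums with [s <> 0] are all equal ([row_sum_conj]).  For
    that particular first row write [x = L P], where [P] swaps the first two
    coordinates and [L] is block lower triangular with blocks [1], [c], [M].
    The trace of [alpha x + x^-1] is affine in the column [c], so by
    orthogonality the sum over [c] vanishes unless the linear part is zero,
    which says that the first row of [M] is [(alpha^-1, 0, ..., 0)].  Then [M]
    is again block lower triangular, and what is left is [q^(2n+1) K_n]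
    ([row_sum_offdiag]).

    Sums over involutions ([invol_sumSS]).  Split the involutions [w] of [n+2]
    points by the image of the last point.  If it is fixed, removing it
    leaves [N_w] unchanged, and gives the first term.  If it is exchanged with
    the point [k] (counted from 0), removing both points lowers [N_w] by
    [n + 1 - k] ([num_N_pair_last]); summing the resulting powers of [q] over
    [k] is a geometric sum, which the factor [q - 1] of the removed 2-cycle
    turns into [q^(n+1) - 1].

    Of the additive character only the homomorphism property and
    non-triviality enter.  The latter holds because the field automorphisms
    are linearly independent, so that the trace is not identically zero. *)

Import Order.TTheory GRing.Theory Num.Theory.

Local Open Scope ring_scope.

Set Implicit Arguments.
Unset Strict Implicit.
Unset Printing Implicit Defensive.

(** * Sums over involutions *)

Lemma involP n (w : 'S_n) : reflect (forall i, w (w i) = i) (w ^+ 2 == 1)%g.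
Proof.
rewrite expgS expg1; apply: (iffP eqP) => [w2 i | w2].
  by rewrite -permM w2 perm1.
by apply/permP=> i; rewrite permM w2 perm1.
Qed.

Lemma lift_perm_inj n (i j : 'I_n.+1) : injective (@lift_perm n i j).
Proof.
move=> s t st; apply/permP=> k; apply: (@lift_inj _ j).
by rewrite -!(lift_perm_lift i) st.
Qed.

Lemma lift_perm_onto n (i j : 'I_n.+1) (w : 'S_n.+1) :
  w i = j -> exists s, lift_perm i j s = w.
Proof.
move=> wi; have wl k : exists k', w (lift i k) == lift j k'.
  have : j != w (lift i k) by rewrite -wi (inj_eq perm_inj) neq_lift.
  by case/unlift_some => k' wE _; exists k'; apply/eqP.
pose f k := xchoose (wl k).
have fE k : lift j (f k) = w (lift i k) by rewrite (eqP (xchooseP (wl k))).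
have f_inj : injective f.
  by move=> k l /(congr1 (lift j)); rewrite !fE => /perm_inj /lift_inj.
exists (perm f_inj); apply/permP=> k.
by case: (unliftP i k) => [l|] ->; rewrite ?lift_perm_id ?lift_perm_lift ?permE ?fE.
Qed.

Lemma reindex_lift_perm (A : nmodType) n (i j : 'I_n.+1)
    (P : pred 'S_n.+1) (F : 'S_n.+1 -> A) :
  \sum_(w | P w && (w i == j)) F w
    = \sum_(s : 'S_n | P (lift_perm i j s)) F (lift_perm i j s).
Proof.
rewrite (reindex (lift_perm i j)) /=; last first.
  exists (fun w => odflt 1%g [pick s | lift_perm i j s == w]) => [s _|w].
    by case: pickP => [t /eqP /lift_perm_inj|/(_ s)] //; rewrite eqxx.
  case/andP=> _ /eqP /lift_perm_onto [s sw].
  by case: pickP => [t /eqP|/(_ s)] //; rewrite sw eqxx.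
by apply: eq_bigl => s; rewrite lift_perm_id eqxx andbT.
Qed.

(** The permutation of [n.+2] points that exchanges the last point with point
    [k] and acts as [t] on the others, in increasing order.  The inner
    [lift_perm] sends [k] to the last of the [n.+1] remaining values because,
    once the value [k] is left out, that one stands for the last point. *)
Definition pair_last n (k : 'I_n.+1) (t : 'S_n) : 'S_n.+2 :=
  lift_perm ord_max (lift ord_max k) (lift_perm k ord_max t).

Section PairLast.
Variables (n : nat) (k : 'I_n.+1) (t : 'S_n).
Let w := pair_last k t.
Let g (a : 'I_n) : 'I_n.+2 := lift ord_max (lift k a).

Lemma pair_last_max : w ord_max = lift ord_max k.
Proof. by rewrite /w /pair_last lift_perm_id. Qed.

Lemma lift_lift_max : lift (lift ord_max k) (ord_max : 'I_n.+1) = ord_max.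
Proof.
by apply: val_inj; rewrite /= /bump; have := ltn_ord k; lia.
Qed.

Lemma lift_lift_comm (a : 'I_n) :
  lift (lift ord_max k) (lift ord_max a) = lift ord_max (lift k a).
Proof.
apply: val_inj; rewrite /= /bump.
have := ltn_ord k; have := ltn_ord a; lia.
Qed.

Lemma pair_last_k : w (lift ord_max k) = ord_max.
Proof. by rewrite /w /pair_last lift_perm_lift lift_perm_id lift_lift_max. Qed.

Lemma pair_last_lift a : w (g a) = g (t a).
Proof. by rewrite /w /pair_last !lift_perm_lift lift_lift_comm. Qed.

Lemma pair_last_invol : (w ^+ 2 == 1)%g = (t ^+ 2 == 1)%g.
Proof.
apply/involP/involP=> [w2 a | t2 i].
  by have := w2 (g a); rewrite !pair_last_lift => /lift_inj /lift_inj.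
case: (unliftP ord_max i) => [j|] ->; last by rewrite pair_last_max pair_last_k.
case: (unliftP k j) => [a|] ->; last by rewrite pair_last_k pair_last_max.
by rewrite !pair_last_lift t2.
Qed.

Lemma sum_pair_last (f : 'I_n.+2 -> nat) :
  (\sum_i f i = f ord_max + f (lift ord_max k) + \sum_a f (g a))%N.
Proof. by rewrite (bigD1_ord ord_max) //= (bigD1_ord k) //= addnA. Qed.

End PairLast.

Lemma num_fixedE n (w : 'S_n) : num_fixed w = (\sum_i (w i == i))%N.
Proof. by rewrite /num_fixed -sum1_card big_mkcond; apply: eq_bigr => i _; rewrite inE; case: eqP. Qed.

Lemma num_NE n (w : 'S_n) :
  num_N w = (\sum_(i < n) \sum_(j < n) ((i < j) && (w j < w i <= j)))%N.
Proof.
rewrite /num_N -sum1_card big_mkcond pair_big /=.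
by apply: eq_bigr => -[i j] _; rewrite inE /=; case: (_ && _).
Qed.

Lemma num_fixed_pair_last n (k : 'I_n.+1) (t : 'S_n) :
  num_fixed (pair_last k t) = num_fixed t.
Proof.
rewrite !num_fixedE (sum_pair_last k) pair_last_max pair_last_k.
rewrite [lift _ _ == _]eq_sym (negPf (neq_lift _ _)) !add0n.
by apply: eq_bigr => a _; rewrite pair_last_lift !(inj_eq lift_inj).
Qed.

(** The pairs [(i, j)] lost with the exchanged points [k] and [max] are
    [(k, max)] and the [(i, max)] with [w i > k].  No other pair involves these
    points, since [max] is neither a first component, nor a value at most some
    other [j], nor a value exceeded by another one. *)
Lemma num_N_pair_last n (k : 'I_n.+1) (t : 'S_n) :
  num_N (pair_last k t) = (n.+1 - k + num_N t)%N.
Proof.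
have lk := ltn_ord k.
have val_g (a : 'I_n) : lift ord_max (lift k a) = bump k a :> nat.
  by rewrite /= {1}/bump /=; have := ltn_ord a; rewrite /bump; lia.
have val_k : lift ord_max k = k :> nat by rewrite /= /bump; lia.
have bump_lt (a : 'I_n) : (bump k a < n.+1)%N.
  by have := ltn_ord a; rewrite /bump; lia.
have bump_gt (a : 'I_n) : (k < bump k a)%N = (k <= a)%N by rewrite /bump; lia.
pose row (i : 'I_n.+2) := (\sum_(j < n.+2)
  ((i < j) && (pair_last k t j < pair_last k t i <= j)))%N.
have rowE i : row i = ((i < n.+1) && (k < pair_last k t i)
      + \sum_(b < n) ((i < bump k b) && (bump k (t b) < pair_last k t i <= bump k b)))%N.
  rewrite /row (sum_pair_last k) pair_last_max pair_last_k val_k -addnA.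
  congr (_ + _)%N; first by rewrite leq_ord andbT.
  rewrite [(_ < pair_last k t i)%N]ltnNge leq_ord andFb andbF add0n.
  by apply: eq_bigr => b _; rewrite pair_last_lift !val_g.
have row_max : row ord_max = 0%N.
  by rewrite rowE ltnn big1 // => b _; rewrite ltnNge (ltnW (bump_lt b)).
have row_k : row (lift ord_max k) = 1%N.
  rewrite rowE pair_last_k val_k lk big1 // => b _.
  by rewrite [(ord_max <= _)%N]leqNgt !bump_lt !andbF.
have row_g a : row (lift ord_max (lift k a))
    = ((k <= t a) + \sum_(b < n) ((a < b) && (t b < t a <= b)))%N.
  rewrite rowE pair_last_lift !val_g bump_lt bump_gt; congr (_ + _)%N.
  by apply: eq_bigr => b _; rewrite leq_bump2 !ltnNge !leq_bump2.
(* As [t] permutes the indices, only the number of values [>= k] matters. *)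
have count_ge : (\sum_(a < n) (k <= t a) = n - k)%N.
  transitivity (\sum_(a < n) (k <= a))%N.
    by rewrite [RHS](reindex_inj (@perm_inj _ t)).
  rewrite -(big_mkord predT (fun a => nat_of_bool (k <= a)%N)) (big_cat_nat (n := k)) //=.
  rewrite big_nat big1 => [|i /andP[_ lt_ik]]; last by rewrite leqNgt lt_ik.
  rewrite add0n big_nat (eq_bigr (fun=> 1%N)) => [|i /andP[-> //]].
  by rewrite -big_nat sum_nat_const_nat muln1.
rewrite !num_NE (sum_pair_last k) -!/(row _) row_max row_k.
by rewrite (eq_bigr _ (fun a _ => row_g a)) big_split /= count_ge addnA subSn.
Qed.

Lemma sum_lift_max n (f : 'I_n.+1 -> nat) :
  (\sum_i f i = f ord_max + \sum_a f (lift ord_max a))%N.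
Proof. by rewrite (bigD1_ord ord_max). Qed.

Lemma num_fixed_lift_max n (s : 'S_n) :
  num_fixed (lift_perm ord_max ord_max s) = (num_fixed s).+1.
Proof.
rewrite !num_fixedE sum_lift_max lift_perm_id eqxx add1n; congr _.+1.
by apply: eq_bigr => a _; rewrite lift_perm_lift (inj_eq lift_inj).
Qed.

Lemma num_N_lift_max n (s : 'S_n) :
  num_N (lift_perm ord_max ord_max s) = num_N s.
Proof.
rewrite !num_NE sum_lift_max big1 ?add0n => [|j _]; last first.
  by rewrite ltnNge leq_ord.
apply: eq_bigr => a _; rewrite sum_lift_max lift_perm_id lift_perm_lift.
rewrite [(ord_max < _)%N]ltnNge leq_ord andFb andbF add0n.
by apply: eq_bigr => b _; rewrite lift_perm_lift !lift_max.
Qed.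

Lemma lift_max_invol n (s : 'S_n) :
  (lift_perm ord_max ord_max s ^+ 2 == 1)%g = (s ^+ 2 == 1)%g.
Proof.
apply/involP/involP=> [w2 a | s2 i].
  by have := w2 (lift ord_max a); rewrite !lift_perm_lift => /lift_inj.
by case: (unliftP ord_max i) => [a|] ->; rewrite ?lift_perm_id // !lift_perm_lift s2.
Qed.

(** Double counting of the points moved by [w]; it reduces every statement
    on 2-cycles below to one on fixed points. *)
Lemma num_2cycles_fixed n (w : 'S_n) : (w ^+ 2 == 1)%g ->
  ((num_2cycles w).*2 + num_fixed w = n)%N.
Proof.
move=> /involP w2.
have porbit2 i : porbit w i = [set i; w i].
  apply/setP=> j; rewrite !inE; apply/porbitP/orP=> [[m ->] | [] /eqP ->].
  - elim: m => [|m [] /eqP IH]; first by left; rewrite expg0 perm1.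
      by right; rewrite expgSr permM IH.
    by left; rewrite expgSr permM IH w2.
  - by exists 0%N; rewrite expg0 perm1.
  - by exists 1%N; rewrite expg1.
have pairs : ((num_2cycles w).*2 = \sum_(i < n) (w i != i))%N.
  rewrite (partition_big (porbit w) [in porbits w]) /= => [|i _]; last exact: imset_f.
  rewrite -muln2 /num_2cycles -sum1_card big_distrl /= big_mkcond [RHS]big_mkcond /=.
  apply: eq_bigr => c _; rewrite !inE /=; case: imsetP => [[i _ ->]|_] //=.
  rewrite (eq_bigl (fun j => j \in porbit w i)) => [|j]; last by rewrite eq_porbit_mem.
  rewrite (eq_bigr (fun=> nat_of_bool (w i != i))) => [|j].
    by rewrite sum_nat_const porbit2 cards2 [i == _]eq_sym; case: (w i == i).
  by rewrite porbit2 !inE => /pred2P[] -> //; rewrite w2 eq_sym.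
rewrite pairs num_fixedE -big_split /= -[RHS]card_ord -sum1_card.
by apply: eq_bigr => i _; case: eqP.
Qed.

Lemma num_2cycles_lift_max n (s : 'S_n) : (s ^+ 2 == 1)%g ->
  num_2cycles (lift_perm ord_max ord_max s) = num_2cycles s.
Proof.
move=> s2; have := num_2cycles_fixed s2.
have := @num_2cycles_fixed _ (lift_perm ord_max ord_max s).
by rewrite lift_max_invol num_fixed_lift_max => /(_ s2); lia.
Qed.

Lemma num_2cycles_pair_last n (k : 'I_n.+1) (t : 'S_n) : (t ^+ 2 == 1)%g ->
  num_2cycles (pair_last k t) = (num_2cycles t).+1.
Proof.
move=> t2; have := num_2cycles_fixed t2.
have := @num_2cycles_fixed _ (pair_last k t).
by rewrite pair_last_invol num_fixed_pair_last => /(_ t2); lia.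
Qed.

Lemma half_mul_pred n : ((n * (n - 1)) %/ 2 = 'C(n, 2))%N.
Proof. by rewrite divn2 subn1 bin2. Qed.

Lemma bin2S n : 'C(n.+1, 2) = ('C(n, 2) + n)%N.
Proof. by rewrite binS bin1. Qed.

Section InvolutionSum.
Variables (A : comPzRingType) (q x : A).

Definition invol_sum n : A :=
  \sum_(w : 'S_n | (w ^+ 2 == 1)%g)
     q ^+ ((n * (n - 1)) %/ 2 + num_N w) * (q - 1) ^+ num_2cycles w
       * x ^+ num_fixed w.

Lemma invol_sum0 : invol_sum 0 = 1.
Proof.
rewrite /invol_sum (big_pred1 1%g) => [|w]; last first.
  by rewrite /= (_ : w = 1%g) ?expg1n ?eqxx //; apply/permP; case.
have := @num_2cycles_fixed 0 1%g; rewrite expg1n eqxx => /(_ isT) ef.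
have [e0 f0] : num_2cycles (1 : 'S_0) = 0%N /\ num_fixed (1 : 'S_0) = 0%N by lia.
by rewrite num_NE big_ord0 e0 f0 !mulr1.
Qed.

Lemma invol_sum1 : invol_sum 1 = x.
Proof.
rewrite /invol_sum (big_pred1 1%g) => [|w]; last first.
  rewrite /= (_ : w = 1%g) ?expg1n ?eqxx //.
  by apply/permP=> i; rewrite !ord1.
have f1 : num_fixed (1 : 'S_1) = 1%N by rewrite num_fixedE big_ord1 perm1 eqxx.
have := @num_2cycles_fixed 1 1%g; rewrite expg1n eqxx => /(_ isT) ef.
have e0 : num_2cycles (1 : 'S_1) = 0%N by lia.
by rewrite num_NE !big_ord1 ltnn f1 e0 mulr1 mul1r.
Qed.

(** The first term collects the involutions fixing the last point, the second
    those exchanging it with some [k]. *)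
Lemma invol_sumSS n :
  invol_sum n.+2 = q ^+ n.+1 * x * invol_sum n.+1
    + q ^+ (n.*2.+2) * (q ^+ n.+1 - 1) * invol_sum n.
Proof.
rewrite /invol_sum (partition_big (fun w : 'S_n.+2 => w ord_max) predT) //=.
rewrite (bigD1_ord ord_max) //=; congr (_ + _).
  rewrite reindex_lift_perm big_distrr /=.
  apply: eq_big => [s|s s2]; first exact: lift_max_invol.
  have {}s2 : (s ^+ 2 == 1)%g by rewrite -lift_max_invol.
  rewrite num_N_lift_max num_2cycles_lift_max // num_fixed_lift_max exprS.
  rewrite !half_mul_pred bin2S addnAC exprD.
  move: (q ^+ n.+1) (q ^+ (_ + _)) (_ ^+ num_2cycles s) (_ ^+ num_fixed s) => a b c d.
  ring.
rewrite (_ : q ^+ _ * _ = \sum_(k < n.+1) q ^+ n.*2.+2 * (q - 1) * q ^+ (n - k)).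
  rewrite big_distrl /=; apply: eq_bigr => k _; have lkn : (k <= n)%N by rewrite leq_ord.
  (* An involution sending the last point to [k] sends [k] back, so that both
     points can be removed one after the other. *)
  rewrite (eq_bigl (fun w : 'S_n.+2 => ((w ^+ 2 == 1)%g && (w (lift ord_max k) == ord_max))
     && (w ord_max == lift ord_max k))) => [|w]; last first.
    case: (w ord_max =P _) => [wm|]; rewrite ?andbF // !andbT.
    by case: involP => // w2; rewrite -wm w2 eqxx.
  rewrite reindex_lift_perm big_distrr /=.
  rewrite (eq_bigl (fun s : 'S_n.+1 => (lift_perm ord_max (lift ord_max k) s ^+ 2 == 1)%g
     && (s k == ord_max))) => [|s]; last first.
    by rewrite lift_perm_lift -(inj_eq (@lift_inj _ (lift ord_max k)) (s k)) lift_lift_max.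
  rewrite reindex_lift_perm; apply: eq_big => [t|t]; first exact: pair_last_invol.
  rewrite -/(pair_last k t) pair_last_invol => t2.
  rewrite num_N_pair_last num_2cycles_pair_last // num_fixed_pair_last.
  rewrite !half_mul_pred !bin2S subSn //.
  have -> : ('C(n, 2) + n + n.+1 + ((n - k).+1 + num_N t)
     = n.*2.+2 + (n - k) + ('C(n, 2) + num_N t))%N by lia.
  rewrite [in LHS]exprD [q ^+ (_ + (n - k))]exprD [(q - 1) ^+ _.+1]exprS.
  move: (q ^+ (_ + num_N t)) (q ^+ n.*2.+2) (q ^+ (n - k)) => a b c.
  move: (_ ^+ num_2cycles t) (_ ^+ num_fixed t) => d e.
  ring.
rewrite subrX1 mulrA big_distrr /= (reindex_inj rev_ord_inj) /=.
by apply: eq_bigr => k _; rewrite subSS.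
Qed.

End InvolutionSum.

(** * Character sums over invertible matrices *)

Section MatrixFacts.
Variable F : fieldType.

Lemma invmx_uniq n (M N : 'M[F]_n) : M *m N = 1%:M -> invmx M = N.
Proof.
move=> MN; have [uM _] := mulmx1_unit MN.
by rewrite -[RHS]mul1mx -(mulVmx uM) -mulmxA MN mulmx1.
Qed.

Lemma unitmx_lblock m n (A : 'M[F]_m) (C : 'M_(n, m)) (D : 'M_n) :
  (block_mx A 0 C D \in unitmx) = (A \in unitmx) && (D \in unitmx).
Proof. by rewrite !unitmxE det_lblock unitrM. Qed.

Lemma invmx_lblock m n (A : 'M[F]_m) (C : 'M_(n, m)) (D : 'M_n) :
  A \in unitmx -> D \in unitmx ->
  invmx (block_mx A 0 C D)
    = block_mx (invmx A) 0 (- (invmx D *m C *m invmx A)) (invmx D).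
Proof.
move=> uA uD; apply: invmx_uniq.
rewrite mulmx_block !(mul0mx, mulmx0, addr0, add0r) !mulmxV // mulmxN.
by rewrite -!mulmxA mulKVmx // subrr -scalar_mx_block.
Qed.

Lemma usubmx_mulr m1 m2 n p (M : 'M[F]_(m1 + m2, n)) (N : 'M_(n, p)) :
  usubmx (M *m N) = usubmx M *m N.
Proof. by rewrite -{1}[M]vsubmxK mul_col_mx col_mxKu. Qed.

Lemma usubmxE m1 m2 n (M : 'M[F]_(m1 + m2, n)) : usubmx M = row_mx 1%:M 0 *m M.
Proof. by rewrite -{2}[M]vsubmxK mul_row_col mul1mx mul0mx addr0. Qed.

(** [GL] acts transitively on nonzero row vectors. *)
Lemma unitmx_row_exists n (s : 'rV[F]_(1 + n)) : s != 0 ->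
  {h : 'M[F]_(1 + n) | h \in unitmx & row_mx 1%:M 0 *m h = s}.
Proof.
move=> s0; pose e : 'rV[F]_(1 + n) := row_mx 1%:M 0.
have ef : e *m col_mx s 0 = s by rewrite mul_row_col mul1mx mul0mx addr0.
have e0 : e != 0.
  apply/eqP=> /(congr1 (fun u : 'rV[F]_(1 + n) => lsubmx u)).
  by rewrite row_mxKl linear0 => /eqP; rewrite oner_eq0.
have [|h uh hE] := @complete_unitmx _ _ _ e (col_mx s 0).
  by rewrite ef !rank_rV s0 e0.
by exists h; rewrite // -/e -hE.
Qed.

(** The permutation matrix exchanging the first two coordinates, in blocks. *)
Definition swap2_mx n : 'M[F]_(1 + (1 + n)) :=
  block_mx 0 (row_mx 1%:M 0) (col_mx 1%:M 0) (block_mx 0 0 0 1%:M).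

Lemma swap2_mxK n : swap2_mx n *m swap2_mx n = 1%:M.
Proof.
rewrite /swap2_mx mulmx_block !(mul0mx, mulmx0, add0r, addr0).
rewrite mul_row_col mul_row_block mul_block_col mul_col_row mulmx_block.
rewrite !(mul0mx, mulmx0, mul1mx, mulmx1, add0r, addr0).
rewrite row_mx0 col_mx0 add_block_mx !(add0r, addr0).
by rewrite -scalar_mx_block -scalar_mx_block.
Qed.

Lemma mxtrace_lblock_swap2 n (c : 'cV[F]_(1 + n)) (M : 'M_(1 + n)) :
  \tr (block_mx 1%:M 0 c M *m swap2_mx n)
    = \tr (row_mx 1%:M 0 *m c) + \tr (drsubmx M).
Proof.
rewrite /swap2_mx mulmx_block !(mul0mx, mulmx0, add0r, addr0) mxtrace_block mxtrace0 add0r.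
rewrite raddfD /= mxtrace_mulC; congr (_ + _).
rewrite -{1}[M]submxK mulmx_block mxtrace_block.
by rewrite !(mul0mx, mulmx0, mulmx1, add0r, addr0) mxtrace0 add0r.
Qed.

End MatrixFacts.

Section AbstractKloosterman.
Variables (F : finFieldType) (A : idomainType) (chi : F -> A).
Hypotheses (chi0 : chi 0 = 1) (chiD : forall x y, chi (x + y) = chi x * chi y).
Hypothesis chi_nontrivial : exists x, chi x != 1.
Let q : A := #|F|%:R.

(** Orthogonality: unless [u = 0], some translation of [c] multiplies the sum
    by a value of [chi] other than 1. *)
Lemma sum_chi_linear n (u : 'rV[F]_n) :
  \sum_(c : 'cV_n) chi (\tr (u *m c)) = if u == 0 then q ^+ n else 0.
Proof.
case: eqP => [->|/eqP u0].
  under eq_bigr do rewrite mul0mx mxtrace0 chi0.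
  by rewrite sumr_const card_mx muln1 natrX.
have [x0 x0P] := chi_nontrivial.
have [j uj] : exists j, u 0 j != 0.
  apply/existsP; apply: contraNT u0 => /existsPn u0; apply/eqP/rowP=> j.
  by rewrite mxE; apply/eqP; have := u0 j; rewrite negbK.
pose c0 : 'cV[F]_n := (x0 / u 0 j) *: delta_mx j 0.
have uc0 : \tr (u *m c0) = x0.
  by rewrite /mxtrace big_ord1 -scalemxAr -colE !mxE mulfVK.
apply/eqP; set S := (X in X == 0).
have : (chi x0 - 1) * S == 0.
  rewrite mulrBl mul1r subr_eq0 [X in _ == X](reindex_inj (addrI c0)) big_distrr /=.
  by apply/eqP/eq_bigr=> c _; rewrite mulmxDr raddfD /= uc0 chiD.
by rewrite mulf_eq0 subr_eq0 (negPf x0P).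
Qed.

Section FixedScalar.
Variable alpha : F.
Hypothesis alpha_neq0 : alpha != 0.

(** The argument of the character in the matrix sum at the scalar [alpha], as
    a class function of [x]. *)
Definition phase n (x : 'M[F]_n) : F := alpha * \tr x + \tr (invmx x).

Definition char_kl n : A := \sum_(x : 'M[F]_n | x \in unitmx) chi (phase x).

Definition row_sum n (r : 'rV[F]_(1 + n)) : A :=
  \sum_(x : 'M[F]_(1 + n) | (x \in unitmx) && (usubmx x == r)) chi (phase x).

(** A matrix with first row [(a, 0)] is block lower triangular, its lower left
    column is free and does not affect the lower right block of the inverse. *)
Lemma sum_usubmx_scalar n (a : F) (G : 'M[F]_n -> 'M[F]_n -> A) : a != 0 ->
  \sum_(x : 'M[F]_(1 + n) | (x \in unitmx) && (usubmx x == row_mx a%:M 0))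
     G (drsubmx x) (drsubmx (invmx x))
  = q ^+ n * \sum_(y : 'M[F]_n | y \in unitmx) G y (invmx y).
Proof.
move=> a0; have ua : (a%:M : 'M[F]_1) \in unitmx by rewrite unitmxE det_scalar1 unitfE.
pose h (p : 'cV[F]_n * 'M[F]_n) : 'M[F]_(1 + n) := block_mx a%:M 0 p.1 p.2.
rewrite (reindex h) /=; last first.
  exists (fun x : 'M[F]_(1 + n) => (dlsubmx x, drsubmx x)) => [[c y]|x] /=.
    by rewrite block_mxKdl block_mxKdr.
  rewrite inE => /andP[_ /eqP xr]; rewrite /h /=.
  by rewrite -{3}[x]vsubmxK xr -[dsubmx x]hsubmxK.
rewrite (eq_bigl (fun p : 'cV[F]_n * 'M[F]_n => xpredT p.1 && (p.2 \in unitmx)))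
  => [|[c y]]; last first.
  by rewrite /h unitmx_lblock ua /= block_mxEv col_mxKu eqxx andbT.
rewrite -(pair_big xpredT (fun y : 'M[F]_n => y \in unitmx)
  (fun c y => G (drsubmx (h (c, y))) (drsubmx (invmx (h (c, y)))))) /=.
rewrite (eq_bigr (fun=> \sum_(y : 'M[F]_n | y \in unitmx) G y (invmx y))) => [|c _].
  by rewrite sumr_const card_mx muln1 -mulr_natl natrX.
by apply: eq_bigr => y uy; rewrite /h invmx_lblock // !block_mxKdr.
Qed.

Lemma row_sum_scalar n (a : F) : a != 0 ->
  row_sum (row_mx a%:M 0 : 'rV_(1 + n)) = chi (alpha * a + a^-1) * q ^+ n * char_kl n.
Proof.
move=> a0; rewrite -mulrA.
rewrite -(@sum_usubmx_scalar n a (fun y z => chi (alpha * \tr y + \tr z)) a0).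
rewrite big_distrr /=; apply: eq_bigr => x /andP[ux /eqP xr].
have xE : x = block_mx a%:M 0 (dlsubmx x) (drsubmx x).
  by rewrite -{1}[x]vsubmxK xr -[dsubmx x]hsubmxK.
move: ux; rewrite /phase xE unitmx_lblock => /andP[ua uy].
rewrite invmx_lblock // !mxtrace_block !block_mxKdr -chiD invmx_scalar !mxtrace_scalar.
by rewrite !mulr1n; congr chi; ring.
Qed.

Lemma row_sum0 n : row_sum (0 : 'rV_(1 + n)) = 0.
Proof.
rewrite /row_sum big1 // => x /andP[ux /eqP x0].
have : usubmx (x *m invmx x) = 0 by rewrite usubmx_mulr x0 mul0mx.
rewrite mulmxV // scalar_mx_block block_mxEv col_mxKu.
move/(congr1 (fun u : 'rV[F]_(1 + n) => lsubmx u)).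
by rewrite row_mxKl linear0 => /eqP; rewrite oner_eq0.
Qed.

(** Conjugation by [g], whose first two rows are [(1, 0)] and [(a, s)], turns
    the first row [(0, 1, 0, ..., 0)] into [(a, s)]. *)
Lemma row_sum_conj n (a : F) (s : 'rV[F]_(1 + n)) : s != 0 ->
  row_sum (row_mx a%:M s : 'rV_(1 + (1 + n))) =
  row_sum (row_mx 0 (row_mx 1%:M 0) : 'rV_(1 + (1 + n))).
Proof.
move=> s0; have [h uh hE] := unitmx_row_exists s0.
pose g : 'M[F]_(1 + (1 + n)) := block_mx 1%:M 0 (col_mx a%:M 0) h.
have ug : g \in unitmx by rewrite unitmx_lblock unitmx1 uh.
have e0g : row_mx 1%:M 0 *m g = row_mx 1%:M 0.
  by rewrite mul_row_block !mul1mx !mul0mx !addr0.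
have rg : row_mx 0 (row_mx 1%:M 0) *m g = row_mx a%:M s.
  by rewrite mul_row_block !mul0mx !add0r hE mul_row_col mul1mx mul0mx addr0.
pose conj (x : 'M[F]_(1 + (1 + n))) := invmx g *m x *m g.
have conj_inj : injective conj.
  apply: (can_inj (g := fun x => g *m x *m invmx g)) => x.
  by rewrite /conj !mulmxA mulmxV // mul1mx mulmxK.
rewrite /row_sum (reindex_inj conj_inj) /conj /=.
apply: eq_big => [x|x /andP[ux _]].
  rewrite !unitmx_mul unitmx_inv ug /= andbT; congr (_ && _).
  rewrite usubmx_mulr usubmxE !mulmxA -{1}e0g mulmxK // -usubmxE -rg.
  by apply/eqP/eqP=> [/(can_inj (mulmxK ug))|->].
have {}ux : x \in unitmx by move: ux; rewrite !unitmx_mul ug unitmx_inv ug andbT.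
rewrite /phase; congr (chi (alpha * _ + _)).
  by rewrite mxtrace_mulC mulmxA mulmxV // mul1mx.
rewrite (@invmx_uniq _ _ _ (invmx g *m invmx x *m g)).
  by rewrite mxtrace_mulC mulmxA mulmxV // mul1mx.
by rewrite -!mulmxA (mulKVmx ug) (mulKVmx ux) mulVmx.
Qed.

(** In the coordinates [x = L P], with [L] block lower triangular and [P] the
    swap of the first two coordinates, the inverse [P L^-1] has a trace of the
    same shape, so the phase is affine in the free column [c] of [L].  Its
    linear part is [alpha e - e M^-1], with [e] the first basis row vector. *)
Lemma row_sum_offdiag n :
  row_sum (row_mx 0 (row_mx 1%:M 0) : 'rV_(1 + (1 + n))) = q ^+ n.*2.+1 * char_kl n.
Proof.
pose e : 'rV[F]_(1 + n) := row_mx 1%:M 0; rewrite -/e.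
pose P := swap2_mx F n; have PK : P *m P = 1%:M by exact: swap2_mxK.
pose h (p : 'M[F]_(1 + n) * 'cV[F]_(1 + n)) : 'M[F]_(1 + (1 + n)) :=
  block_mx 1%:M 0 p.2 p.1 *m P.
have [uP _] := mulmx1_unit PK.
have h_row p : usubmx (h p) = row_mx 0 e.
  rewrite /h usubmx_mulr block_mxEv col_mxKu.
  by rewrite /P /swap2_mx mul_row_block !mul1mx !mul0mx !addr0.
rewrite /row_sum (reindex h) /=; last first.
  exists (fun x : 'M[F]_(1 + (1 + n)) => (drsubmx (x *m P), dlsubmx (x *m P))) => [[M c]|x] /=.
    by rewrite -mulmxA PK mulmx1 block_mxKdl block_mxKdr.
  rewrite inE => /andP[_ /eqP xr]; rewrite /h /=.
  have -> : block_mx 1%:M 0 (dlsubmx (x *m P)) (drsubmx (x *m P)) = x *m P.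
    rewrite -{3}[x *m P]vsubmxK usubmx_mulr xr -[dsubmx (x *m P)]hsubmxK.
    by rewrite mul_row_block !mul0mx !add0r mul_row_col mul_row_block
      !(mul1mx, mul0mx, addr0, mulmx0) row_mx0.
  by rewrite -mulmxA PK mulmx1.
rewrite (eq_bigl (fun p : 'M[F]_(1 + n) * 'cV[F]_(1 + n) => (p.1 \in unitmx) && xpredT p.2))
  => [|[M c]]; last first.
  by rewrite h_row eqxx /h unitmx_mul uP unitmx_lblock unitmx1 !andbT.
rewrite -(pair_big (fun M : 'M[F]_(1 + n) => M \in unitmx) xpredT
  (fun M c => chi (phase (h (M, c))))) /=.
have phaseE M c : M \in unitmx -> phase (h (M, c))
   = \tr ((alpha *: e - e *m invmx M) *m c)
     + (alpha * \tr (drsubmx M) + \tr (drsubmx (invmx M))).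
  move=> uM; rewrite /phase mxtrace_lblock_swap2.
  have -> : invmx (h (M, c)) = P *m block_mx 1%:M 0 (- (invmx M *m c)) (invmx M).
    apply: invmx_uniq; rewrite /h /= -mulmxA (mulmxA P) PK mul1mx mulmx_block.
    rewrite !(mul0mx, mulmx0, mul1mx, mulmx1, add0r, addr0) mulmxN mulKVmx // subrr.
    by rewrite mulmxV // -scalar_mx_block.
  rewrite [\tr (P *m _)]mxtrace_mulC mxtrace_lblock_swap2 -/e.
  rewrite mulmxBl raddfB /= -scalemxAl mxtraceZ mulmxN raddfN /= mulmxA; ring.
(* Summing over [c] leaves the [M] with first row [(alpha^-1, 0)]. *)
rewrite (eq_bigr (fun M : 'M[F]_(1 + n) => (if usubmx M == row_mx (alpha^-1)%:M 0 then
   q ^+ n.+1 * chi (alpha * \tr (drsubmx M) + \tr (drsubmx (invmx M))) else 0)))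
  => [|M uM]; last first.
  under eq_bigr => c _ do rewrite phaseE // chiD.
  rewrite -big_distrl /= sum_chi_linear.
  suff -> : (alpha *: e - e *m invmx M == 0) = (usubmx M == row_mx alpha^-1%:M 0).
    by case: ifP => // _; rewrite mul0r.
  have -> : row_mx alpha^-1%:M 0 = alpha^-1 *: e.
    by rewrite /e scale_row_mx scaler0 scale_scalar_mx mulr1.
  rewrite subr_eq0 usubmxE -/e; apply/eqP/eqP => [ae|eM].
    apply: (scalerI alpha_neq0); rewrite scalerA divff // scale1r.
    by rewrite scalemxAl ae mulmxKV.
  by rewrite -[e in RHS]scale1r -(divff alpha_neq0) -scalerA -eM -scalemxAl mulmxK.
rewrite -big_mkcondr /= -big_distrr /=.
rewrite (@sum_usubmx_scalar n _ (fun y z => chi (alpha * \tr y + \tr z))) ?invr_eq0 //.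
by rewrite mulrA -exprD addSn addnn.
Qed.

Lemma char_kl_rows n : char_kl (1 + n) =
  \sum_(a : F) \sum_(s : 'rV[F]_n) row_sum (row_mx a%:M s : 'rV_(1 + n)).
Proof.
rewrite /char_kl (partition_big (fun x : 'M[F]_(1 + n) => usubmx x) predT) //=.
rewrite (reindex (fun p : F * 'rV[F]_n => row_mx p.1%:M p.2 : 'rV[F]_(1 + n))) /=.
  by rewrite (pair_bigA _ (fun a s => row_sum (row_mx a%:M s : 'rV[F]_(1 + n)))).
exists (fun r : 'rV[F]_(1 + n) => (lsubmx r 0 0, rsubmx r)) => [[a s]|r] _ /=.
  by rewrite row_mxKl row_mxKr mxE eqxx.
by rewrite -mx11_scalar hsubmxK.
Qed.

Lemma char_kl0 : char_kl 0 = 1.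
Proof.
rewrite /char_kl (big_pred1 0) => [|x]; last by rewrite [x]flatmx0 unitmxE det_mx00 unitr1 /= eqxx.
by rewrite /phase /mxtrace !big_ord0 mulr0 addr0 chi0.
Qed.

Lemma char_kl1 : char_kl 1 = \sum_(a : F | a != 0) chi (alpha * a + a^-1).
Proof.
rewrite (char_kl_rows 0) [RHS]big_mkcond; apply: eq_bigr => a _.
rewrite (big_pred1 0) => [|s]; last by rewrite [s]thinmx0 /= eqxx.
case: eqP => [->|/eqP a0] /=; last by rewrite row_sum_scalar // char_kl0 !mulr1.
by rewrite raddf0 row_mx0 row_sum0.
Qed.

Lemma char_klSS n : char_kl n.+2 = q ^+ n.+1 * char_kl 1 * char_kl n.+1
   + q ^+ n.*2.+2 * (q ^+ n.+1 - 1) * char_kl n.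
Proof.
rewrite (char_kl_rows n.+1).
under eq_bigr => a _ do rewrite (bigD1 0) //=.
rewrite big_split /=; congr (_ + _).
  rewrite char_kl1 mulrAC big_distrr [RHS]big_mkcond /=; apply: eq_bigr => a _.
  case: eqP => [->|/eqP a0] /=; last by rewrite row_sum_scalar //; ring.
  by rewrite raddf0 row_mx0 row_sum0.
rewrite (eq_bigr (fun=> (q ^+ n.+1 - 1) * (q ^+ n.*2.+1 * char_kl n))) => [|a _].
  by rewrite sumr_const -mulr_natl exprS [q ^+ n.*2.+2]exprS; ring.
rewrite (eq_bigr (fun=> q ^+ n.*2.+1 * char_kl n)) => [|s s0].
  rewrite sumr_const -mulr_natl; congr (_ * _).
  rewrite cardC1 card_mx mul1n -subn1 natrB ?natrX //.
  by rewrite expn_gt0; apply/orP; left; apply/card_gt0P; exists 0.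
by rewrite (@row_sum_conj n) // row_sum_offdiag.
Qed.

End FixedScalar.

End AbstractKloosterman.

(** * The additive character *)

Section RootOfUnity.

Local Open Scope complex_scope.
Variable R : realType.

Definition cis (t : R) : R[i] := cos t +i* sin t.

Lemma cisD s t : cis (s + t) = cis s * cis t.
Proof. by rewrite /cis cosD sinD; simpc; congr (_ +i* _); rewrite addrC. Qed.

Lemma cisMn t n : cis (t *+ n) = cis t ^+ n.
Proof.
elim: n => [|n IHn]; first by rewrite mulr0n expr0 /cis cos0 sin0.
by rewrite mulrS cisD IHn exprS.
Qed.

(** [cos t = 1 - 2 sin^2 (t / 2)], and the sine is positive on [(0, pi)]. *)
Lemma cis_neq1 (t : R) : 0 < t < pi *+ 2 -> cis t != 1.
Proof.
move=> /andP[t0 tpi]; have st : 0 < sin (t / 2) by apply: sin_gt0_pi; lra.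
apply/eqP => /(congr1 (@complex.Re R)) /=.
have {1}-> : t = (t / 2) *+ 2 by rewrite mulr2n -splitr.
rewrite cos_mulr2n cos2sin2; have : 0 < sin (t / 2) ^+ 2 by rewrite exprn_gt0. lra.
Qed.

Lemma cexp_real_i (t : R) : cexp (t%:C * 'i) = cis t.
Proof.
have -> : t%:C * 'i = 0 +i* t by simpc.
by rewrite /cexp /= expR0 mul1r.
Qed.

End RootOfUnity.

(** The trace is the sum of all elements of the Galois group with coefficients
    1, and these are linearly independent. *)
Lemma galTrace_nontrivial (F0 : fieldType) (L : splittingFieldType F0)
  (K E : {subfield L}) : exists2 a, a \in E & galTrace K E a != 0.
Proof.
have [a Ea sa] := gal_independent_contra (c_ := fun=> 1) (group1 'Gal(E / K)) (oner_neq0 L).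
by exists a => //; move: sa; under eq_bigr do rewrite mul1r.
Qed.

Section AddChar.

Local Open Scope complex_scope.
Variables (R : realType) (F : finFieldType) (p : nat) (charFp : p \in [pchar F]).
Let zeta : R[i] := cis (pi *+ 2 / p%:R).
Let p_gt0 : (0 < p)%N.
Proof. exact: prime_gt0 (pcharf_prime charFp). Qed.
Let pR_neq0 : p%:R != 0 :> R.
Proof. by rewrite pnatr_eq0 -lt0n. Qed.

Lemma addCharE x : addChar R charFp x = zeta ^+ (absTrace charFp x).
Proof.
rewrite /addChar /zeta -cisMn -cexp_real_i; congr cexp.
rewrite -!(rmorph_nat (real_complex R)) -fmorphV mulrAC -mulrA mulrC mulrA.
rewrite -!rmorphM /=; congr (_%:C * _).
by rewrite -[_ *+ absTrace _ _]mulr_natr -[pi *+ 2]mulr_natl; ring.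
Qed.

Lemma zetaXp : zeta ^+ p = 1.
Proof.
rewrite /zeta -cisMn -[_ *+ p]mulr_natr mulfVK //.
by rewrite /cis cos2pi sin2pi.
Qed.

Lemma zetaX_neq1 k : (0 < k < p)%N -> zeta ^+ k != 1.
Proof.
move=> /andP[k0 kp]; rewrite -cisMn; apply: cis_neq1.
have pi2 : 0 < pi *+ 2 :> R by rewrite pmulrn_lgt0 // pi_gt0.
have pR : 0 < p%:R :> R by rewrite ltr0n.
rewrite pmulrn_lgt0 // divr_gt0 //= -[_ *+ k]mulr_natr.
by rewrite mulrAC ltr_pdivrMr // ltr_pM2l // ltr_nat.
Qed.

Let L := pPrimeCharType charFp.

Lemma absTraceD x y : absTrace charFp (x + y) = absTrace charFp x + absTrace charFp y.
Proof.
apply: (fmorph_inj (in_alg L)); rewrite rmorphD /= !absTraceE.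
exact: (raddfD (galTrace 1%AS {:L})).
Qed.

(** Addition in ['F_p] is addition of representatives modulo [p], which is
    harmless in the exponent of a [p]-th root of unity. *)
Lemma addCharD x y : addChar R charFp (x + y) = addChar R charFp x * addChar R charFp y.
Proof.
rewrite !addCharE absTraceD -exprD /=.
have zX : zeta ^+ (Zp_trunc (pdiv p)).+2 = 1.
  by rewrite Fp_cast ?(pcharf_prime charFp) ?zetaXp.
by rewrite expr_mod.
Qed.

Lemma addChar0 : addChar R charFp 0 = 1.
Proof.
have : absTrace charFp (0 + 0) = absTrace charFp 0 by rewrite addr0.
by rewrite absTraceD => /eqP; rewrite -subr_eq0 addrK addCharE => /eqP ->.
Qed.

Lemma absTrace_nontrivial : exists x, absTrace charFp x != 0.
Proof.
have [a _ tra] := @galTrace_nontrivial _ L 1%AS {:L}%AS.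
by exists a; apply: contra tra => /eqP ta; rewrite -absTraceE ta scale0r.
Qed.

Lemma addChar_nontrivial : exists x, addChar R charFp x != 1.
Proof.
have [x trx] := absTrace_nontrivial; exists x; rewrite addCharE zetaX_neq1 //.
rewrite lt0n -[X in (_ < X)%N](Fp_cast (pcharf_prime charFp)) ltn_ord andbT.
exact: trx.
Qed.

End AddChar.

(** * The two recursions agree *)

Section Comparison.

Variables (R : realType) (F : finFieldType) (p : nat) (charFp : p \in [pchar F]).

Lemma mxKloostermanE n (alpha : F) :
  mxKloosterman R charFp (alpha%:M : 'M[F]_n) = char_kl (addChar R charFp) alpha n.
Proof.
apply: eq_bigr => x _.
by rewrite /mxAddChar mul_scalar_mx mxtraceD mxtraceZ.
Qed.

Lemma char_kl_invol_sum n (alpha : F) : alpha != 0 ->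
  char_kl (addChar R charFp) alpha n
    = invol_sum #|F|%:R (kloosterman R charFp alpha) n.
Proof.
move=> alpha0; set K := kloosterman _ _ _.
have chi0 := addChar0 R charFp; have chiD := @addCharD R F p charFp.
have chiN := addChar_nontrivial R charFp.
have K1 : char_kl (addChar R charFp) alpha 1 = K by exact: char_kl1.
suff [] : char_kl (addChar R charFp) alpha n = invol_sum #|F|%:R K n
   /\ char_kl (addChar R charFp) alpha n.+1 = invol_sum #|F|%:R K n.+1 by [].
elim: n => [|n [IH0 IH1]]; first by rewrite invol_sum0 invol_sum1 K1 char_kl0.
by split; rewrite // invol_sumSS char_klSS // K1 IH0 IH1.
Qed.

End Comparison.

Theorem theorem1p5 (R : realType) (F : finFieldType) (p : nat)
    (charFp : p \in [pchar F]) (n : nat) (alpha : F) (alpha_neq0 : alpha != 0) :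
  mxKloosterman R charFp (alpha%:M : 'M[F]_n) =
  \sum_(w : 'S_n | (w ^+ 2 == 1)%g)
     #|F|%:R ^+ ((n * (n - 1)) %/ 2 + num_N w)
       * (#|F|%:R - 1) ^+ num_2cycles w
       * kloosterman R charFp alpha ^+ num_fixed w.
Proof. by rewrite mxKloostermanE char_kl_invol_sum. Qed.
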